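(* Let $\Delta$ and $k$ be positive integers. Then there exists a constant $c(\Delta,k)$, depending only on $\Delta$ and $k$, such that the Ramsey number of any $k$-uniform hypergraph $H$ with $n$ vertices and maximum degree $\Delta$ satisfies \[ r(H) \le c(\Delta,k)\, n. \]
   Context: A hypergraph consists of a finite vertex set and a set of edges, which are subsets of the vertex set; it is $k$-uniform if every edge has exactly $k$ vertices. The degree of a vertex is the number of edges containing it, and the maximum degree is the largest degree of a vertex. $K_N^{(k)}$ denotes the complete $k$-uniform hypergraph on $N$ vertices. The Ramsey number $r(H)$ of a $k$-uniform hypergraph $H$ is the smallest $N$ such that every $2$-colouring of the edges of $K_N^{(k)}$ contains a monochromatic copy of $H$ (a copy is a not necessarily induced subhypergraph isomorphic to $H$). *)

(* Defs.v *)
From mathcomp Require Import all_boot.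

Set Implicit Arguments.
Unset Strict Implicit.
Unset Printing Implicit Defensive.

Record hypergraph : Type := Hypergraph {
  vertex : finType;
  edges : {set {set vertex}}
}.

Definition uniform (k : nat) (H : hypergraph) : Prop :=
  forall e : {set vertex H}, e \in edges H -> #|e| = k.

Definition degree (H : hypergraph) (v : vertex H) : nat :=
  #|[set e in edges H | v \in e]|.

Definition max_degree (H : hypergraph) : nat :=
  \max_(v : vertex H) degree v.

Definition complete_hypergraph (k N : nat) : hypergraph :=
  @Hypergraph 'I_N [set e : {set 'I_N} | #|e| == k].

Definition subhypergraph (H : hypergraph)
    (W : {set vertex H}) (F : {set {set vertex H}}) : Prop :=
  F \subset edges H /\ forall e : {set vertex H}, e \in F -> e \subset W.

(* [(W, F)] is a subhypergraph of [G] isomorphic to [H]; it need not be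
   induced, so [F] may omit edges of [G] contained in [W]. *)
Definition is_copy (H G : hypergraph)
    (W : {set vertex G}) (F : {set {set vertex G}}) : Prop :=
  subhypergraph W F /\
  exists f : vertex H -> vertex G,
    [/\ injective f,
        f @: [set: vertex H] = W
      & [set f @: e | e : {set vertex H} in edges H] = F].

(* A 2-colouring of the edges of the complete hypergraph is given by a
   function on all vertex subsets; its values off the k-subsets are never
   consulted, since the edges of a copy are edges of the ambient hypergraph. *)
Definition ramsey_property (k : nat) (H : hypergraph) (N : nat) : Prop :=
  forall col : {set vertex (complete_hypergraph k N)} -> bool,
  exists (W : {set vertex (complete_hypergraph k N)})
         (F : {set {set vertex (complete_hypergraph k N)}}),
    is_copy H W F /\
    exists b : bool, forall e, e \in F -> col e = b.

Definition is_ramsey_number (k : nat) (H : hypergraph) (r : nat) : Prop :=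
  ramsey_property k H r /\
  forall N : nat, ramsey_property k H N -> r <= N.

(* Main.v *)
Require Import Defs.
From mathcomp Require Import all_boot.
From mathcomp Require Import zify.
From Stdlib Require Import Classical.

(** Let m = Delta * k and l = m + 1. Colour the vertices of H with l colours so that each
    edge is rainbow. By Ramsey's theorem and averaging, for some colour beta the set G
    of l-tuples of points all of whose k-subsets have colour beta has positive density.
    Choose one tuple x in G and embed H greedily, colour class by colour class: a
    partial embedding of an edge e is admissible when the tuple which has the images of
    the embedded vertices of e in their coordinates, and the entries of x elsewhere,
    lies in G. A vertex w of colour i is in trouble if its set of admissible images
    contains [x i] but is small. For fixed other data, this is an unlikely event in the choice
    of [x i], so some x in G makes trouble rare at every colour and for each of the
    boundedly many isomorphism types of the edges at w. During the embedding the
    conditional probability of trouble at each later vertex is kept under control: it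
    grows by a bounded factor each time a neighbour is embedded, at the cost of a small
    proportion of the images of that neighbour. *)

Set Implicit Arguments.
Unset Strict Implicit.
Unset Printing Implicit Defensive.

(** * Ramsey's theorem for finite sets *)

Definition homogeneous (T : finType) (col : {set T} -> bool) (k : nat)
    (b : bool) (A : {set T}) : bool :=
  [forall e : {set T}, (e \subset A) && (#|e| == k) ==> (col e == b)].

Lemma homogeneousP (T : finType) (col : {set T} -> bool) k b (A : {set T}) :
  reflect (forall e : {set T}, e \subset A -> #|e| = k -> col e = b)
          (homogeneous col k b A).
Proof.
apply: (iffP forallP) => [h e eA ek | h e].
  by have:= h e; rewrite eA ek eqxx => /eqP.
by apply/implyP => /andP[eA /eqP ek]; rewrite (h e).
Qed.

Lemma exists_subset_card (T : finType) (A : {set T}) m :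
  m <= #|A| -> exists2 B : {set T}, B \subset A & #|B| = m.
Proof.
elim: m => [|m IH] lemA; first by exists set0; rewrite ?sub0set ?cards0.
have [B BA cB] := IH (ltnW lemA).
have /subsetPn[x xA xB] : ~~ (A \subset B).
  by apply/negP => /subset_leq_card; rewrite cB leqNgt lemA.
exists (x |: B); first by rewrite subUset sub1set xA.
by rewrite cardsU1 xB cB.
Qed.

(** Erdos-Szekeres induction: fix a point [x], find a large set that is homogeneous for the link
    colouring of [x], and inside it look for a homogeneous set with the target of the link colour
    lowered by one, so that [x] can be added. Targets depend on the colour so that this recursion
    closes. *)
Lemma ramsey_sets (k : nat) : forall l : bool -> nat, exists R, forall (T : finType)
    (col : {set T} -> bool) (A : {set T}), R <= #|A| ->
  exists b (B : {set T}), [/\ B \subset A, #|B| = l b & homogeneous col k b B].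
Proof.
elim: k => [|k IHk] l.
  exists (maxn (l true) (l false)) => T col A; rewrite geq_max => /andP[h1 h2].
  exists (col set0).
  have [|B BA cB] := @exists_subset_card _ A (l (col set0)); first by case: col.
  exists B; split => //; apply/homogeneousP => e _ /eqP.
  by rewrite cards_eq0 => /eqP->.
have [s] := ubnP (l true + l false); elim: s l => // s IHs l les.
have l0 b : l b = 0 -> forall (T : finType) (col : {set T} -> bool) (A : {set T}),
    exists b (B : {set T}), [/\ B \subset A, #|B| = l b & homogeneous col k.+1 b B].
  move=> lb T col A; exists b, set0; rewrite sub0set cards0 lb; split => //.
  by apply/homogeneousP => e; rewrite subset0 => /eqP->; rewrite cards0.
have [/l0 h|pt] := posnP (l true); first by exists 0 => *; apply: h.
have [/l0 h|pf] := posnP (l false); first by exists 0 => *; apply: h.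
pose l' b c := if c == b then (l c).-1 else l c.
have [Rt ht] : exists R, forall (T : finType) (col : {set T} -> bool) (A : {set T}),
    R <= #|A| -> exists b (B : {set T}),
    [/\ B \subset A, #|B| = l' true b & homogeneous col k.+1 b B].
  by apply: IHs; rewrite /l' /=; lia.
have [Rf hf] : exists R, forall (T : finType) (col : {set T} -> bool) (A : {set T}),
    R <= #|A| -> exists b (B : {set T}),
    [/\ B \subset A, #|B| = l' false b & homogeneous col k.+1 b B].
  by apply: IHs; rewrite /l' /=; lia.
have [R hR] := IHk (fun=> maxn Rt Rf).
exists R.+1 => T col A cA.
have /card_gt0P[x xA] : 0 < #|A| by apply: leq_trans cA.
have [|b [B [BA cB /homogeneousP hB]]] := hR T (fun e => col (x |: e)) (A :\ x).
  by move: cA; rewrite (cardsD1 x) xA.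
have [c [C [CB cC /homogeneousP hC]]] : exists c (C : {set T}),
    [/\ C \subset B, #|C| = l' b c & homogeneous col k.+1 c C].
  by case: b hB => _; [apply: ht|apply: hf]; rewrite cB leq_max leqnn ?orbT.
have xC : x \notin C.
  by apply/negP => /(subsetP CB)/(subsetP BA); rewrite !inE eqxx.
have CA : C \subset A.
  by apply: subset_trans CB (subset_trans BA _); apply: subsetDl.
have [cb|ncb] := eqVneq c b; last first.
  exists c, C; split => //; last exact/homogeneousP.
  by rewrite cC /l' (negPf ncb).
exists c, (x |: C); split.
- by rewrite subUset sub1set xA.
- by rewrite cardsU1 xC cC /l' cb eqxx; case: (b); lia.
apply/homogeneousP => e eC ek.
have [xe|xe] := boolP (x \in e); last first.
  apply: hC ek; apply/subsetP => y ye; have:= subsetP eC y ye.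
  by rewrite !inE; case: eqP => // yx; move: xe; rewrite -yx ye.
rewrite -(setD1K xe) cb; apply: hB.
  by rewrite subDset (subset_trans eC) // setUS.
by move: ek; rewrite (cardsD1 x) xe add1n => -[].
Qed.

Lemma ramsey_tuple (k l : nat) : exists2 R, 0 < R & forall col : {set 'I_R} -> bool,
  exists b (h : {ffun 'I_l -> 'I_R}),
    injective h /\ homogeneous col k b [set h a | a : 'I_l].
Proof.
have [R hR] := ramsey_sets k (fun=> l).
exists R.+1 => // col.
have [|b [B [_ cB hB]]] := hR _ col [set: 'I_R.+1]; first by rewrite cardsT card_ord.
exists b, [ffun a : 'I_l => enum_val (cast_ord (esym cB) a)]; split.
  by move=> a a'; rewrite !ffunE => /enum_val_inj/cast_ord_inj.
apply/homogeneousP => e eh; apply: (homogeneousP _ _ _ _ hB).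
apply: (subset_trans eh); apply/subsetP => _ /imsetP[a _ ->].
by rewrite ffunE enum_valP.
Qed.

(** * Proper colouring of graphs of bounded degree *)

Lemma greedy_colouring (T : finType) (r : rel T) (m : nat) :
  symmetric r -> (forall x, #|[set y | r x y]| <= m) ->
  exists f : T -> 'I_m.+1, forall x y, x != y -> r x y -> f x != f y.
Proof.
move=> rC rm.
suff [f hf] : exists f : T -> 'I_m.+1,
    {in [set: T] &, forall x y, x != y -> r x y -> f x != f y}.
  by exists f => x y; apply: hf; rewrite inE.
move: [set: T] => A; have [s] := ubnP #|A|; elim: s A => // s IH A cA.
have [->|/set0Pn[x xA]] := eqVneq A set0; first by exists (fun=> ord0) => ? ?; rewrite inE.
have [|f hf] := IH (A :\ x); first by move: cA; rewrite (cardsD1 x) xA.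
have /subsetPn[c _ cN] : ~~ ([set: 'I_m.+1] \subset [set f y | y in [set y | r x y]]).
  apply/negP => /subset_leq_card; rewrite cardsT card_ord.
  by move/leq_trans => /(_ _ (leq_imset_card _ _))/leq_trans/(_ (rm x)); rewrite ltnn.
exists (fun y => if y == x then c else f y) => y z yA zA yz ryz.
have nb w : r x w -> c != f w.
  by move=> rw; apply: contraNneq cN => ->; apply: imset_f; rewrite inE.
case: (eqVneq y x) => [yx|nyx]; case: (eqVneq z x) => [zx|nzx].
- by move: yz; rewrite yx zx eqxx.
- by apply: nb; rewrite -yx.
- by rewrite eq_sym; apply: nb; rewrite rC -zx.
- by apply: hf; rewrite // !inE ?nyx ?nzx.
Qed.

(** * Uniform averages over functions *)

Section Resampling.
Variables (X : finType).

Definition pull (L W : finType) (mu : L -> W) (psi : {ffun W -> X}) : {ffun L -> X} :=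
  [ffun a => psi (mu a)].

Definition put (L W : finType) (mu : L -> W) (z : {ffun L -> X}) (psi : {ffun W -> X}) :
    {ffun W -> X} :=
  [ffun w => if [pick a | mu a == w] is Some a then z a else psi w].

Definition upd (W : finType) (psi : {ffun W -> X}) (v : W) (y : X) : {ffun W -> X} :=
  [ffun w => if w == v then y else psi w].

(* The involution [(psi, z) |-> (put mu z psi, pull mu psi)] swaps the two sides. *)
Lemma sum_pull (L W : finType) (mu : L -> W) (f : {ffun L -> X} -> nat) :
  injective mu ->
  (\sum_psi f (pull mu psi)) * #|X| ^ #|L| = #|X| ^ #|W| * \sum_z f z.
Proof.
move=> mu_inj.
have putE z psi a : put mu z psi (mu a) = z a.
  rewrite ffunE; case: pickP => [a' /eqP/mu_inj->//|/(_ a)]; by rewrite eqxx.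
pose F (p : {ffun W -> X} * {ffun L -> X}) := (put mu p.2 p.1, pull mu p.1).
have FK : involutive F.
  case=> psi z; congr (_, _); last by apply/ffunP => a; rewrite ffunE putE.
  apply/ffunP => w; rewrite ffunE; case: pickP => [a /eqP<-|h]; first by rewrite ffunE.
  by rewrite ffunE; case: pickP => // a; rewrite h.
rewrite -!card_ffun -sum_nat_const big_distrl /=.
under eq_bigr => psi _ do rewrite mulnC -sum_nat_const.
rewrite !pair_bigA /= (reindex_inj (inv_inj FK)) /=.
apply: eq_bigr => -[psi z] _ /=; congr f.
by apply/ffunP => a; rewrite ffunE putE.
Qed.

(** Resampling one coordinate preserves the uniform measure: exchanging [psi v] with [y] is an
    involution. *)
Lemma sum_upd (W : finType) (v : W) (f : {ffun W -> X} -> nat) :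
  \sum_psi \sum_y f (upd psi v y) = #|X| * \sum_psi f psi.
Proof.
pose F (p : {ffun W -> X} * X) := (upd p.1 v p.2, p.1 v).
have FK : involutive F.
  case=> psi z; congr (_, _); last by rewrite ffunE eqxx.
  by apply/ffunP => w; rewrite !ffunE /=; case: eqP => // ->.
rewrite pair_bigA /= big_distrr /=.
under [RHS]eq_bigr => psi _ do rewrite -sum_nat_const.
rewrite pair_bigA /= (reindex_inj (inv_inj FK)) /=.
apply: eq_bigr => -[psi z] _ /=; congr f.
by apply/ffunP => w; rewrite !ffunE; case: eqP => // ->.
Qed.

End Resampling.

(** * Positive density of homogeneous tuples *)

Lemma subset_imset_lift (T X : finType) (g : T -> X) (D : {set T}) (e : {set X}) :
  e \subset g @: D -> exists e' : {set T}, [/\ e' \subset D, #|e'| = #|e| & g @: e' = e].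
Proof.
move=> eD; have [->|/set0Pn[y0 /(subsetP eD)/imsetP[x0 _ _]]] := eqVneq e set0.
  by exists set0; rewrite sub0set imset0 !cards0.
have /fin_all_exists[a ha] y : exists x, y \in e -> x \in D /\ g x = y.
  have [/(subsetP eD)/imsetP[x xD ->]|_] := boolP (y \in e); first by exists x.
  by exists x0.
have gaK : {in e, cancel a g} by move=> y /ha[].
exists (a @: e); split.
- by apply/subsetP => _ /imsetP[y /ha[? _] ->].
- by rewrite card_in_imset //; apply: can_in_inj gaK.
- by rewrite -imset_comp (eq_in_imset gaK) imset_id.
Qed.

(** Double counting over maps [g : 'I_R -> X]: by Ramsey's theorem each [g] has a homogeneous
    [l]-tuple among its values, while a fixed injective choice of [l] indices turns a uniform [g]
    into a uniform tuple. The factor 2 pays for the choice of colour. *)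
Lemma homogeneous_density (k l : nat) : exists K, forall (X : finType)
    (col : {set X} -> bool), 0 < #|X| -> exists b,
  #|X| ^ l <= K * #|[set t : {ffun 'I_l -> X} | homogeneous col k b [set t a | a : 'I_l]]|.
Proof.
have [R _ hR] := ramsey_tuple k l.
exists (#|{ffun 'I_l -> 'I_R}| * 2) => X col X0.
pose G b := [set t : {ffun 'I_l -> X} | homogeneous col k b [set t a | a : 'I_l]].
have cnt : #|X| ^ R * #|X| ^ l <= #|X| ^ R * (#|{ffun 'I_l -> 'I_R}| * (#|G true| + #|G false|)).
  pose I b (h : {ffun 'I_l -> 'I_R}) (g : {ffun 'I_R -> X}) : nat :=
    injectiveb h && (pull h g \in G b).
  have h1 (g : {ffun 'I_R -> X}) : 1 <= \sum_h (I true h g + I false h g).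
    have [b [h [h_inj hb]]] := hR (fun A => col [set g r | r in A]).
    rewrite (bigD1 h) //=.
    suff : I b h g = 1 by case: b hb => _ ->; lia.
    apply/eqP; rewrite eqb1; apply/andP; split; first exact/injectiveP.
    rewrite inE; apply/homogeneousP => e ee ek.
    have hE : [set (pull h g) a | a : 'I_l] = g @: [set h a | a : 'I_l].
      by rewrite -imset_comp; apply: eq_imset => a; rewrite ffunE.
    rewrite hE in ee.
    (* [g] may repeat values; one preimage for each point of [e] gives an index set of the same size
       [k]. *)
    have [e' [e'D ce' <-]] := subset_imset_lift ee.
    by rewrite (homogeneousP _ _ _ _ hb e') // ce'.
  have h2 b h : (\sum_g I b h g) * #|X| ^ l <= #|X| ^ R * #|G b|.
    rewrite /I; have [/injectiveP h_inj|_] /= := boolP (injectiveb h); last first.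
      by rewrite sum_nat_const muln0.
    have := sum_pull (fun t : {ffun 'I_l -> X} => t \in G b : nat) h_inj.
    by rewrite !card_ord => ->; rewrite -(sum1_card [in G b]) [X in _ <= _ * X]big_mkcond.
  have h3 : #|X| ^ R <= \sum_g \sum_h (I true h g + I false h g).
    by rewrite -{1}[R]card_ord -card_ffun -sum1_card; apply: leq_sum.
  apply: leq_trans (leq_mul h3 (leqnn _)) _.
  rewrite exchange_big big_distrl mulnCA -sum_nat_const /=; apply: leq_sum => h _.
  by rewrite big_split /= mulnDl mulnDr leq_add.
move: cnt; rewrite leq_pmul2l ?expn_gt0 ?X0 // => cnt.
have [le|lt] := leqP #|G true| #|G false|; [exists false|exists true];
  by rewrite (leq_trans cnt) // -mulnA leq_mul2l; apply/orP; right; rewrite -/(G _); lia.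
Qed.

(** Union bound: [G] has density at least [1/K], each [P j] at most [1/M]. *)
Lemma avoid_rare (J Y : finType) (G : {set Y}) (P : J -> {set Y}) (K M : nat) :
  0 < #|Y| -> #|Y| <= K * #|G| -> (forall j, #|P j| * M <= #|Y|) -> #|J| * K < M ->
  exists2 y, y \in G & forall j, y \notin P j.
Proof.
move=> Y0 YG PY JM.
have [/subsetP sub|/subsetPn[y yG yP]] := boolP (G \subset \bigcup_j P j); last first.
  exists y => // j; apply: contra yP => yj; by apply/bigcupP; exists j.
suff : #|G| * M <= #|J| * #|Y| by nia.
apply: (@leq_trans ((\sum_j #|P j|) * M)).
  rewrite leq_mul2r; apply/orP; right.
  apply: (@leq_trans #|\bigcup_j P j|); first exact/subset_leq_card/subsetP.
  by elim/big_rec2: _ => [|j a A _ h]; rewrite ?cards0 // (leq_trans (leq_card_setU _ _)) // leq_add2l.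
by rewrite big_distrl -sum_nat_const /=; apply: leq_sum.
Qed.

(** * Candidate images and the rarity of trouble *)

Section Candidates.
Variables (X : finType) (l : nat) (G : {set {ffun 'I_l -> X}}).

(* [L] is the vertex set of H, or a set of at most m labels; a (partial) tuple in [L]
   with entries [None] is an edge that misses some colours. *)
Definition plug (L : finType) (i : 'I_l) (x : {ffun 'I_l -> X}) (z : {ffun L -> X})
    (u : {ffun 'I_l -> option L}) (y : X) : {ffun 'I_l -> X} :=
  [ffun c : 'I_l => if c < i then (if u c is Some a then z a else x c)
                    else if c == i then y else x c].

Definition cand (L : finType) (S : {set {ffun 'I_l -> option L}}) (i : 'I_l)
    (x : {ffun 'I_l -> X}) (z : {ffun L -> X}) : {set X} :=
  [set y | [forall u in S, plug i x z u y \in G]].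

Definition bad (L : finType) (S : {set {ffun 'I_l -> option L}}) (i : 'I_l) (b : nat)
    (x : {ffun 'I_l -> X}) (z : {ffun L -> X}) : bool :=
  (x i \in cand S i x z) && (#|cand S i x z| * b < #|X|).

Lemma eq_cand (L : finType) (S : {set {ffun 'I_l -> option L}}) (i : 'I_l) x
    (z z' : {ffun L -> X}) :
  (forall u (c : 'I_l) a, u \in S -> c < i -> u c = Some a -> z a = z' a) ->
  cand S i x z = cand S i x z'.
Proof.
move=> h; apply/setP => y; rewrite !inE; apply: eq_forallb => u.
have [uS|//] := boolP (u \in S).
suff -> : plug i x z u y = plug i x z' u y by [].
apply/ffunP => c; rewrite !ffunE; case: ifP => // ci.
by case uc : (u c) => [a|] //; apply: (h _ _ _ uS ci uc).
Qed.

(* The candidate set does not depend on the coordinate [x i], which must fall in it. *)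
Lemma bad_rare (L : finType) (S : {set {ffun 'I_l -> option L}}) (i : 'I_l) b (z : {ffun L -> X}) :
  0 < #|X| -> (\sum_x bad S i b x z) * b <= #|X| ^ l.
Proof.
move=> X0; rewrite -(leq_pmul2l X0) mulnA -(sum_upd i) -expnS expnSr.
have -> : #|X| ^ l = #|{ffun 'I_l -> X}| by rewrite card_ffun card_ord.
rewrite -sum_nat_const big_distrl /=; apply: leq_sum => x _.
have cE y : cand S i (upd x i y) z = cand S i x z.
  apply/setP => y'; rewrite !inE; apply: eq_forallb => u.
  suff -> : plug i (upd x i y) z u y' = plug i x z u y' by [].
  apply/ffunP => c; rewrite !ffunE; case: (eqVneq c i) => [->|//]; by rewrite ltnn.
under eq_bigr => y _ do rewrite /bad cE ffunE eqxx.
have [lt|_] := ltnP (_ * b) #|X|; last first.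
  by rewrite big1 ?mul0n // => y _; rewrite andbF.
under eq_bigr => y _ do rewrite andbT.
by rewrite -[X in X * b]big_mkcond sum1_card ltnW.
Qed.

(** Markov's inequality: by [bad_rare], trouble has probability at most [1/(q * t)] over random [x]
    and [z], so its probability over [z] exceeds [1/q] for at most a [1/t] proportion of the [x]. *)
Lemma often_bad_rare (L : finType) (S : {set {ffun 'I_l -> option L}}) (i : 'I_l) q t :
  0 < #|X| -> 0 < q ->
  #|[set x | #|X| ^ #|L| < (\sum_z bad S i (q * t) x z) * q]| * t <= #|X| ^ l.
Proof.
move=> X0 q0; set P := [set x | _].
rewrite -(leq_pmul2l (_ : 0 < #|X| ^ #|L| * q)) ?muln_gt0 ?expn_gt0 ?X0 //.
apply: (@leq_trans ((\sum_x \sum_z bad S i (q * t) x z) * (q * t) * q)).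
  have : #|P| * #|X| ^ #|L| <= (\sum_x \sum_z bad S i (q * t) x z) * q.
    rewrite -sum_nat_const big_mkcond big_distrl /=; apply: leq_sum => x _.
    by rewrite inE; case: ltnP => // /ltnW.
  by move/(leq_mul (leqnn (q * t))); nia.
rewrite [X in _ <= X]mulnAC leq_mul2r; apply/orP; right.
rewrite exchange_big big_distrl -card_ffun -sum_nat_const /=.
by apply: leq_sum => z _; apply: bad_rare.
Qed.

Definition relabel (L V : finType) (mu : L -> V) (u : {ffun 'I_l -> option L}) :
    {ffun 'I_l -> option V} := [ffun c => omap mu (u c)].

(** Trouble depends on [S] only up to renaming of vertices, so an [x] chosen for boundedly many sets
    of labels serves every [V]. *)
Lemma bad_relabel (L V : finType) (mu : L -> V) (S : {set {ffun 'I_l -> option V}})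
    (i : 'I_l) b x psi :
  (forall e c v, e \in S -> e c = Some v -> exists a, mu a = v) ->
  bad S i b x psi = bad (relabel mu @^-1: S) i b x (pull mu psi).
Proof.
move=> hS.
have plugE u y : plug i x (pull mu psi) u y = plug i x psi (relabel mu u) y.
  by apply/ffunP => c; rewrite !ffunE; case: (u c) => [a|] //=; rewrite ffunE.
suff cE : cand S i x psi = cand (relabel mu @^-1: S) i x (pull mu psi) by rewrite /bad cE.
apply/setP => y; rewrite !inE; apply/forall_inP/forall_inP => h u.
  by rewrite inE plugE => /h.
move=> uS; suff [u' u'E] : exists u', relabel mu u' = u.
  by have := h u'; rewrite inE plugE u'E; apply.
have /fin_all_exists[f hf] c : exists o, omap mu o = u c.
  by case E : (u c) => [v|]; [have [a <-] := hS _ _ _ uS E; exists (Some a)|exists None].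
by exists (finfun f); apply/ffunP => c; rewrite !ffunE hf.
Qed.

End Candidates.

(** * Greedy embedding under control of the risk *)

Section Embedding.
Variables (X V : finType) (l : nat) (G : {set {ffun 'I_l -> X}}).
Variables (col : V -> 'I_l) (E : {set {ffun 'I_l -> option V}}).
Variables (x : {ffun 'I_l -> X}) (m : nat) (kap b q : nat -> nat).

Definition star (w : V) := [set e in E | e (col w) == Some w].
Definition link (w : V) := [set v | [exists e in star w, e (col v) == Some v]].

Hypothesis E_col : forall e c v, e \in E -> e c = Some v -> col v = c.
Hypothesis m_gt0 : 0 < m.
Hypothesis link_le : forall w, #|link w| <= m.
Hypothesis kap_gt0 : forall i, 0 < kap i.
Hypothesis kap_homo : forall i j, i < j -> kap i.+1 <= kap j.
Hypothesis kap_b : forall i, 2 * m * b i <= kap i.+1.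
Hypothesis kap_q : forall i, kap i ^ m < q i.
Hypothesis X_large : forall i : 'I_l, 2 * #|V| * b i < #|X|.
Hypothesis xG : x \in G.
Hypothesis x_good : forall w,
  (\sum_psi bad G (star w) (col w) (b (col w)) x psi) * q (col w) <= #|X| ^ #|V|.

Definition merge (A : {set V}) (phi psi : {ffun V -> X}) : {ffun V -> X} :=
  [ffun v => if v \in A then phi v else psi v].

(* [#|X| ^ #|V|] times the probability that [w] is in trouble when [phi] is extended at random
   from [A] to all of [V]. *)
Definition risk (w : V) (A : {set V}) (phi : {ffun V -> X}) : nat :=
  \sum_psi bad G (star w) (col w) (b (col w)) x (merge A phi psi).

Definition partial_edge (A : {set V}) (phi : {ffun V -> X}) (e : {ffun 'I_l -> option V}) :=
  [ffun c => if e c is Some v then if v \in A then phi v else x c else x c].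

(** The invariant of the embedding; colours are filled in increasing order. As [link w] has at most
    [m] elements and [kap i ^ m < q i], the last field keeps the conditional probability of trouble
    below 1. *)
Record embedded (A : {set V}) (phi : {ffun V -> X}) : Prop := Embedded {
  emb_down : forall u v, v \in A -> col u < col v -> u \in A;
  emb_inj : {in A &, injective phi};
  emb_edge : forall e, e \in E -> partial_edge A phi e \in G;
  emb_risk : forall w, w \notin A ->
    risk w A phi * q (col w) <= #|X| ^ #|V| * kap (col w) ^ #|link w :&: A| }.

Lemma starP w e : reflect (e \in E /\ e (col w) = Some w) (e \in star w).
Proof. by rewrite inE; apply: (iffP andP) => -[? /eqP]. Qed.

Lemma linkP w v :
  reflect (exists e, [/\ e \in E, e (col w) = Some w & e (col v) = Some v]) (v \in link w).
Proof.
rewrite inE; apply: (iffP exists_inP) => [[e /starP[? ?] /eqP ?]|[e [? ? ?]]]; exists e => //.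
  exact/starP.
exact/eqP.
Qed.

Lemma link_sym w v : (v \in link w) = (w \in link v).
Proof. by apply/linkP/linkP => -[e [? ? ?]]; exists e. Qed.

Lemma link_col w v : v \in link w -> col v = col w -> v = w.
Proof. by case/linkP => e [_ ew ev] cE; move: ev; rewrite cE ew => -[]. Qed.

Lemma merge_upd (A : {set V}) phi psi w y : w \notin A ->
  merge (w |: A) (upd phi w y) psi = merge A phi (upd psi w y).
Proof.
move=> wA; apply/ffunP => v; rewrite !ffunE !inE.
by case: eqVneq => [->|_] //=; rewrite (negPf wA).
Qed.

(** Martingale property: exposing the image of [w] at random preserves the expected risk. *)
Lemma sum_risk u (A : {set V}) phi w : w \notin A ->
  \sum_y risk u (w |: A) (upd phi w y) = #|X| * risk u A phi.
Proof.
move=> wA; rewrite -(sum_upd w) exchange_big /=.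
by apply: eq_bigr => psi _; apply: eq_bigr => y _; rewrite merge_upd.
Qed.

(** Trouble at [u] reads only the images of vertices that share an edge with [u]. *)
Lemma risk_nonlink u (A : {set V}) phi w y : w \notin A -> w \notin link u ->
  risk u (w |: A) (upd phi w y) = risk u A phi.
Proof.
move=> wA wu; apply: eq_bigr => psi _; rewrite merge_upd // /bad.
rewrite (@eq_cand _ _ _ _ _ _ _ _ (merge A phi psi)) // => e c v /starP[eE eu] _ ec.
rewrite !ffunE; case: (v \in A) => //; case: eqP => // vw; case/negP: wu.
by apply/linkP; exists e; rewrite -vw (E_col eE ec).
Qed.

Definition risky u (A : {set V}) phi w :=
  [set y | kap (col w).+1 * risk u A phi < risk u (w |: A) (upd phi w y)].

(** Markov's inequality for the average in [sum_risk]. If the current risk is 0, all extended risks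
    vanish and the strict inequality in [risky] leaves no [y]. *)
Lemma card_risky u (A : {set V}) phi w : w \notin A ->
  #|risky u A phi w| * kap (col w).+1 <= #|X|.
Proof.
move=> wA; have := sum_risk u phi wA; set F := risk u A phi => sumE.
have : #|risky u A phi w| * (kap (col w).+1 * F).+1 <= #|X| * F.
  rewrite -sumE -sum_nat_const big_mkcond /=; apply: leq_sum => y _.
  by rewrite inE; case: ltnP.
rewrite mulnS mulnA; have [->|F0] := posnP F.
  by rewrite !muln0 addn0 leqn0 => /eqP->.
by move/(leq_trans (leq_addl _ _)); rewrite leq_pmul2r.
Qed.

Lemma embedded_set0 phi : embedded set0 phi.
Proof.
split=> [u v|u v|e eE|w _]; rewrite ?inE //.
  by have -> // : partial_edge set0 phi e = x;
    apply/ffunP => c; rewrite ffunE; case: (e c) => // v; rewrite inE.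
rewrite setI0 cards0 muln1; apply: leq_trans (x_good w).
rewrite leq_mul2r; apply/orP; right; apply: leq_sum => psi _.
by have -> // : merge set0 phi psi = psi; apply/ffunP => v; rewrite ffunE inE.
Qed.

(** The next vertex [w] has least colour among those left. It has many candidates, since otherwise
    trouble would be certain; one of them is neither used nor risky for a vertex of [link w]. *)
Lemma embedded_step (A : {set V}) phi : embedded A phi -> A != setT ->
  exists w y, w \notin A /\ embedded (w |: A) (upd phi w y).
Proof.
move=> [down inj edge rsk] AT.
have /subsetPn[w0 _ w0A] : ~~ ([set: V] \subset A) by rewrite subTset.
case: (@arg_minnP _ w0 [pred v | v \notin A] (fun v => col v : nat) w0A) => w /= wA wmin.
have lowA v : col v < col w -> v \in A.
  by move=> vw; apply: contraLR vw => /wmin; rewrite -leqNgt.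
have Alow v : v \in A -> col v <= col w.
  by move=> vA; rewrite leqNgt; apply: contra wA; apply: down.
have plugE e y : e \in star w ->
    plug (col w) x phi e y = partial_edge (w |: A) (upd phi w y) e.
  case/starP => eE ew; apply/ffunP => c; rewrite !ffunE.
  case: ltngtP => [cw|wc|/val_inj cw]; last by rewrite cw eqxx ew !inE !ffunE eqxx.
    case ec : (e c) => [v|] //; have cv := E_col eE ec.
    have vA : v \in A by apply: lowA; rewrite cv.
    by rewrite !inE !ffunE vA orbT; case: eqP => // vw; rewrite -vw vA in wA.
  have -> : (c == col w) = false by apply/eqP => cw; rewrite cw ltnn in wc.
  case ec : (e c) => [v|] //; have cv := E_col eE ec.
  have vA : v \in A = false.
    by apply/negP => /Alow; rewrite cv leqNgt wc.
  by rewrite !inE vA orbF; case: eqP => // vw; rewrite -cv vw ltnn in wc.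
set C := cand G (star w) (col w) x phi.
have Clarge : #|X| <= #|C| * b (col w).
  rewrite leqNgt; apply/negP => small.
  (* Placing [x (col w)] at [w] leaves all partial edges unchanged, so the invariant makes it a
     candidate. *)
  have xC : x (col w) \in C.
    rewrite inE; apply/forall_inP => e es; rewrite plugE //.
    have /starP[eE _] := es.
    suff -> : partial_edge (w |: A) (upd phi w (x (col w))) e = partial_edge A phi e.
      exact: edge.
    apply/ffunP => c; rewrite !ffunE; case ec : (e c) => [v|] //.
    rewrite !inE !ffunE; case: eqP => // vw; rewrite vw (negPf wA) /=.
    by rewrite -vw (E_col eE ec).
  (* All vertices of colour below [col w] are embedded, so every completion [psi] has the same
     candidates and is in trouble: the risk is total, against [kap_q]. *)
  have rE : risk w A phi = #|X| ^ #|V|.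
    rewrite -card_ffun -sum1_card; apply: eq_bigr => psi _; rewrite /bad.
    rewrite (@eq_cand _ _ _ _ _ _ _ _ phi) -/C ?xC ?small // => e c v /starP[eE _] cw ec.
    by rewrite ffunE lowA // (E_col eE ec).
  have := rsk w wA; rewrite rE leq_pmul2l; last by rewrite expn_gt0; apply/orP; left; lia.
  rewrite leqNgt; apply/negP; rewrite negbK; apply: leq_ltn_trans (kap_q _).
  by rewrite leq_pexp2l // (leq_trans _ (link_le w)) // subset_leq_card // subsetIl.
pose U := phi @: A :|: \bigcup_(u in link w) risky u A phi w.
have /subsetPn[y yC yU] : ~~ (C \subset U).
  apply/negP => /subset_leq_card CU.
  pose s := \sum_(u in link w) #|risky u A phi w|.
  have Us : #|U| <= #|V| + s.
    rewrite (leq_trans (leq_card_setU _ _)) // leq_add //.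
      by rewrite (leq_trans (leq_imset_card _ _)) ?max_card.
    rewrite /s; elim/big_rec2: _ => [|u n D _ h]; rewrite ?cards0 //.
    by rewrite (leq_trans (leq_card_setU _ _)) // leq_add2l.
  have sX : s * kap (col w).+1 <= m * #|X|.
    apply: (@leq_trans (#|link w| * #|X|)); last by rewrite leq_mul2r link_le orbT.
    rewrite /s big_distrl -sum_nat_const /=; apply: leq_sum => u _; exact: card_risky.
  (* Risky values take up at most half of the guaranteed size of [C]; by [X_large] the used points
     take up less than the other half. *)
  have s2 : s * (2 * b (col w)) <= #|X|.
    rewrite -(leq_pmul2l m_gt0); apply: leq_trans sX.
    by rewrite mulnCA leq_mul2l mulnA (mulnC m) kap_b orbT.
  have := X_large (col w); have : #|C| * b (col w) <= (#|V| + s) * b (col w).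
    by rewrite leq_mul2r (leq_trans CU) ?orbT.
  nia.
move: yU; rewrite inE negb_or => /andP[yA yR].
have updA v : v \in A -> upd phi w y v = phi v.
  by move=> vA; rewrite ffunE; case: eqP => // vw; rewrite -vw vA in wA.
have updw : upd phi w y w = y by rewrite ffunE eqxx.
exists w, y; split=> //; split.
- move=> u v /setU1P[->|vA] uv; rewrite inE ?(lowA u) ?orbT //.
  exact: leq_trans uv (Alow v vA).
- move=> u v /setU1P[->|uA] /setU1P[->|vA] //; rewrite ?updw ?updA //.
  + by move=> yE; case/negP: yA; apply/imsetP; exists v.
  + by move=> yE; case/negP: yA; apply/imsetP; exists u.
  + exact: inj.
- move=> e eE; have [es|es] := boolP (e \in star w).
    by rewrite -plugE //; move: yC; rewrite inE => /forall_inP; apply.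
  suff -> : partial_edge (w |: A) (upd phi w y) e = partial_edge A phi e by apply: edge.
  apply/ffunP => c; rewrite !ffunE.
  case ec : (e c) => [v|] //; rewrite !inE; case: eqP => //= vw.
    by case/negP: es; apply/starP; rewrite -{1}vw (E_col eE ec) ec vw.
  by rewrite ffunE; move/eqP/negPf: vw => ->.
- move=> u; rewrite inE negb_or => /andP[]; rewrite inE => uw uA.
  have [wu|wu] := boolP (w \in link u); last first.
    rewrite risk_nonlink // (leq_trans (rsk u uA)) // leq_mul2l leq_pexp2l ?orbT //.
    by rewrite subset_leq_card // setIS // subsetUr.
  (* Linked vertices of equal colour coincide. The strict inequality is what bounds [kap (col w).+1]
     by [kap (col u)]. *)
  have cwu : col w < col u.
    rewrite ltn_neqAle wmin // andbT; apply: contraNneq uw => /val_inj cE.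
    by rewrite (link_col wu cE).
  have ry : risk u (w |: A) (upd phi w y) <= kap (col u) * risk u A phi.
    apply: (@leq_trans (kap (col w).+1 * risk u A phi)); last first.
      by rewrite leq_mul2r kap_homo ?orbT.
    rewrite leqNgt; apply: contra yR => yu; apply/bigcupP; exists u; last by rewrite inE.
    by rewrite link_sym.
  have -> : link u :&: (w |: A) = w |: (link u :&: A).
    apply/setP => v; rewrite !inE; case: (eqVneq v w) => [->|] //=; move: wu; by rewrite inE => ->.
  rewrite cardsU1 !inE (negPf wA) andbF add1n expnS mulnCA.
  apply: (@leq_trans (kap (col u) * risk u A phi * q (col u))); first by rewrite leq_mul2r ry orbT.
  by rewrite -mulnA leq_mul2l rsk ?orbT.
Qed.

Lemma greedy_embedding : exists phi : {ffun V -> X}, injective phi /\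
  forall e, e \in E -> [ffun c => if e c is Some v then phi v else x c] \in G.
Proof.
suff H n (A : {set V}) phi : #|~: A| <= n -> embedded A phi -> exists phi', embedded setT phi'.
  case: (pickP (fun v : V => true)) => [v0 _|V0]; last first.
    have [y0 _] : exists y : V -> X, True by exists (fun v => x (col v)).
    exists (finfun y0); split=> [v|e eE]; first by have := V0 v.
    suff -> : [ffun c => if e c is Some v then finfun y0 v else x c] = x by [].
    by apply/ffunP => c; rewrite ffunE; case: (e c) => // v; have := V0 v.
  (* Any starting function serves: no vertex is embedded yet. *)
  have [phi [_ inj edge _]] := H _ set0 [ffun v => x (col v)] (leqnn _) (embedded_set0 _).
  exists phi; split=> [u v|e /edge]; first by apply: inj; rewrite inE.
  suff -> : partial_edge setT phi e = [ffun c => if e c is Some v then phi v else x c] by [].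
  apply/ffunP => c; rewrite !ffunE.
  by case: (e c) => // v; rewrite inE.
elim: n A phi => [|n IH] A phi cA eA; have [AT|AT] := eqVneq A setT.
- by exists phi; rewrite -AT.
- case/eqP: AT; apply/setP => v; move: cA; rewrite leqn0 cards_eq0 => /eqP/setP/(_ v).
  by rewrite !inE => /negbFE.
- by exists phi; rewrite -AT.
have [w [y [wA ewA]]] := embedded_step eA AT.
apply: IH ewA; rewrite -ltnS; apply: leq_trans cA.
by rewrite setCU setIC -setDE [X in _ < X](cardsD1 w) inE wA.
Qed.

End Embedding.

(** * Least values, constants and assembly *)

Lemma ex_least (P : nat -> Prop) n : P n -> exists r, [/\ P r, r <= n & forall p, P p -> r <= p].
Proof.
elim/ltn_ind: n => n IH Pn.
(* [P] is an arbitrary proposition, so excluded middle replaces a search for the minimum. *)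
have [[p [pn Pp]]|none] := classic (exists p, p < n /\ P p).
  by have [r [Pr rp rmin]] := IH p pn Pp; exists r; split=> //; apply: leq_trans rp (ltnW pn).
exists n; split=> // p Pp; rewrite leqNgt; apply/negP => pn.
by apply: none; exists p.
Qed.

(* Allowed growth factor of the risk of a vertex of colour [i]: the thresholds
   [q i = risk_growth i ^ m + 1] and [b i = q i * T] depend on it, and embedding a vertex of
   colour [i] excludes, besides used points, at most half of its candidates once the next
   factor is at least [2 * m * b i]. *)
Fixpoint risk_growth (m T i : nat) : nat :=
  if i is i'.+1 then 2 * m * ((risk_growth m T i' ^ m).+1 * T) else 1.

Lemma risk_growth_gt0 m T i : 0 < m -> 0 < T -> 0 < risk_growth m T i.
Proof. by case: i => //= i m0 T0; rewrite !muln_gt0 m0 T0. Qed.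

Lemma risk_growth_homo m T : 0 < m -> 0 < T ->
  {homo risk_growth m T : i j / i <= j >-> i <= j}.
Proof.
move=> m0 T0; apply: homo_leq => // [|i]; first exact: leq_trans.
rewrite /= mulnCA mulSn; apply: leq_trans (leq_addl _ _).
apply: (@leq_trans (risk_growth m T i ^ m)).
  by rewrite -{1}[risk_growth m T i]expn1 leq_pexp2l // risk_growth_gt0.
by rewrite -[X in X <= _]muln1 leq_mul2l !muln_gt0 m0 T0 orbT.
Qed.

(** A vertex covered by an edge is adjacent to itself, in agreement with [link]. *)
Definition adjacent (H : hypergraph) : rel (vertex H) :=
  fun v w => [exists e in edges H, (v \in e) && (w \in e)].

Lemma adjacent_sym (H : hypergraph) : symmetric (@adjacent H).
Proof. by move=> v w; apply: eq_existsb => e; rewrite [_ && (w \in e)]andbC. Qed.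

Lemma card_adjacent (H : hypergraph) k v : uniform k H ->
  #|[set w | @adjacent H v w]| <= max_degree H * k.
Proof.
move=> Hk; pose D := [set e in edges H | v \in e].
apply: (@leq_trans (\sum_(e in D) #|e|)).
  apply: (@leq_trans #|\bigcup_(e in D) e|).
    apply/subset_leq_card/subsetP => w; rewrite inE => /exists_inP[e eH /andP[ve we]].
    by apply/bigcupP; exists e; rewrite // inE eH.
  elim/big_rec2: _ => [|e n A _ h]; rewrite ?cards0 //.
  by rewrite (leq_trans (leq_card_setU _ _)) // leq_add2l.
rewrite (eq_bigr (fun=> k)) => [|e]; last by rewrite inE => /andP[/Hk].
by rewrite sum_nat_const leq_mul2r (@leq_bigmax _ (@degree H) v) orbT.
Qed.

Lemma linear_ramsey_property (Delta k : nat) : 0 < Delta -> 0 < k ->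
  exists c, forall H : hypergraph, uniform k H -> max_degree H = Delta ->
    ramsey_property k H (c * #|vertex H|).
Proof.
move=> D0 k0; pose m := Delta * k; pose l := m.+1.
have m0 : 0 < m by rewrite muln_gt0 D0.
have [K hK] := homogeneous_density k l.
(* A shape describes the edges at a vertex up to renaming, with [d <= m] labels for the linked
   vertices; hence [J] depends only on [Delta] and [k]. *)
pose shape : finType := {d : 'I_m.+1 & {set {ffun 'I_l -> option 'I_d}}}.
pose J : finType := ('I_l * shape)%type.
(* Just large enough for the union bound over [J] inside a set of density [1/K]. *)
pose T := (#|J| * K).+1.
pose kap := risk_growth m T; pose q i := (kap i ^ m).+1; pose b i := q i * T.
(* The sum covers [2 * b i] for every colour; the extra 1 makes [X_large] strict, as [n > 0]. *)
exists (\sum_(i < l) 2 * b i).+1 => H Hk HD colour.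
set n := #|vertex H| in colour *.
have n0 : 0 < n.
  rewrite lt0n; apply/eqP => V0; move: D0; rewrite -HD /max_degree big_pred0 // => v.
  by have := fintype0 v V0.
set N := _ * n in colour *.
have N0 : 0 < #|'I_N| by rewrite card_ord muln_gt0.
have [beta dens] := hK 'I_N colour N0.
set G := [set t | _] in dens.
pose P (j : J) := [set x : {ffun 'I_l -> 'I_N} |
  #|'I_N| ^ #|'I_(tag j.2)| < (\sum_z bad G (tagged j.2) j.1 (q j.1 * T) x z) * q j.1].
have [x xG xP] : exists2 x, x \in G & forall j, x \notin P j.
  have card_t : #|{ffun 'I_l -> 'I_N}| = #|'I_N| ^ l by rewrite card_ffun (card_ord l).
  apply: (@avoid_rare J _ G P K T); rewrite ?card_t ?expn_gt0 ?N0 //.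
  by case=> i [d S]; apply: often_bad_rare.
have adj_le v : #|[set w | @adjacent H v w]| <= m.
  by rewrite /m -HD; apply: card_adjacent.
have [f fP] := greedy_colouring (@adjacent_sym H) adj_le.
(* The vertices of an edge have distinct colours, so listing them by colour loses none. *)
pose pe (e : {set vertex H}) : {ffun 'I_l -> option (vertex H)} :=
  [ffun c => [pick v in e | f v == c]].
have peP e c v : pe e c = Some v -> v \in e /\ f v = c.
  by rewrite ffunE; case: pickP => // w /andP[we /eqP fw] [<-].
have peS e v : e \in edges H -> v \in e -> pe e (f v) = Some v.
  move=> eH ve; rewrite ffunE; case: pickP => [w /andP[we fw]|/(_ v)]; last by rewrite ve eqxx.
  congr Some; apply: contraTeq fw => wv; apply: fP wv _.
  by apply/exists_inP; exists e; rewrite ?we.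
pose E := [set pe e | e in edges H].
have E_col e c v : e \in E -> e c = Some v -> f v = c.
  by case/imsetP => e' _ -> /peP[].
have link_le w : #|link f E w| <= m.
  apply: leq_trans (adj_le w); apply/subset_leq_card/subsetP => v.
  case/linkP => _ [/imsetP[e eH ->] /peP[we _] /peP[ve _]].
  by rewrite inE; apply/exists_inP; exists e; rewrite ?we.
have x_good w : (\sum_psi bad G (star f E w) (f w) (b (f w)) x psi) * q (f w)
    <= #|'I_N| ^ #|vertex H|.
  (* Labelling [link w] turns the average over maps on all vertices into one over maps on labels,
     where [x] avoids the event [P] for this shape. *)
  pose mu (a : 'I_#|link f E w|) := enum_val a.
  have mu_inj : injective mu := @enum_val_inj _ _.
  have muS e c v : e \in star f E w -> e c = Some v -> exists a, mu a = v.
    move=> /starP[eE ew] ec; have vw : v \in link f E w.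
      by apply/linkP; exists e; rewrite (E_col _ _ _ eE ec).
    by exists (enum_rank_in vw v); rewrite /mu enum_rankK_in.
  under eq_bigr => psi _ do rewrite (bad_relabel _ _ _ _ _ muS).
  have pos : 0 < #|'I_N| ^ #|'I_#|link f E w| | by rewrite expn_gt0 N0.
  rewrite -(leq_pmul2r pos) mulnAC.
  rewrite (sum_pull (fun z => bad G _ (f w) (b (f w)) x z : nat) mu_inj).
  rewrite -mulnA leq_mul2l leqNgt; apply/orP; right.
  pose d : 'I_m.+1 := Ordinal (link_le w : #|link f E w| < m.+1).
  have := xP (f w, Tagged (fun d : 'I_m.+1 => {set {ffun 'I_l -> option 'I_d}})
    (relabel mu @^-1: star f E w : {set {ffun 'I_l -> option 'I_d}})).
  by rewrite inE.
have T0 : 0 < T by [].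
have [||||phi [phi_inj phiE]] := greedy_embedding (q := q) (b := b) (kap := kap)
    E_col m0 link_le _ _ _ (fun i => ltnSn _) _ xG x_good.
- by move=> i; apply: risk_growth_gt0.
- by move=> i j; apply: risk_growth_homo.
- by move=> i.
- move=> i; rewrite card_ord /N (bigD1 i) //= mulSn -/n.
  rewrite mulnDl mulnAC; lia.
have colE e : e \in edges H -> colour (phi @: e) = beta.
  (* [phi @: e] has [k] elements because [phi] is injective, and all are entries of a tuple in [G];
     the other entries, taken from [x], do no harm. *)
  move=> eH; have := phiE _ (imset_f pe eH); rewrite inE => /homogeneousP; apply.
    apply/subsetP => _ /imsetP[v ve ->]; apply/imsetP; exists (f v) => //.
    by rewrite ffunE peS.
  by rewrite card_imset // Hk.
exists (phi @: setT), [set phi @: e | e : {set vertex H} in edges H]; split; last first.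
  by exists beta => _ /imsetP[e eH ->]; apply: colE.
split; last by exists phi.
split=> [|_ /imsetP[e eH ->]]; last by rewrite imsetS ?subsetT.
by apply/subsetP => _ /imsetP[e eH ->]; rewrite inE card_imset // Hk.
Qed.

Theorem theorem1 (Delta k : nat) (hDelta : 0 < Delta) (hk : 0 < k) :
  exists c : nat, forall H : hypergraph,
    uniform k H -> max_degree H = Delta ->
    exists r : nat, is_ramsey_number k H r /\ r <= c * #|vertex H|.
Proof.
have [c hc] := linear_ramsey_property hDelta hk; exists c => H Hk HD.
by have [r [? ? ?]] := ex_least (hc H Hk HD); exists r.
Qed.
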